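(* Let $\Omega$ be a semigroup, $(L,\mu,p)$ a Hom-associative algebra with product $x\cdot y$, and $\{N_\alpha:L\to L\}_{\alpha\in\Omega}$ a Nijenhuis family operator on it. Then $(L,\{\prec_\alpha,\succ_\alpha,\curlyvee_{\alpha,\beta}\}_{\alpha,\beta\in\Omega},p)$ is a Hom-NS-family algebra, where $$x\prec_\alpha y=x\cdot N_\alpha y,\qquad x\succ_\alpha y=N_\alpha x\cdot y,\qquad x\curlyvee_{\alpha,\beta}y=-N_{\alpha\beta}(x\cdot y)\qquad(x,y\in L,\ \alpha,\beta\in\Omega).$$
   Context: Work over a field $\mathbb{K}$ of characteristic $0$. A Hom-associative algebra $(L,\mu,p)$ is a vector space $L$ with a linear map $p:L\to L$ and a bilinear product $\mu(x,y)=x\cdot y$ such that $p(x\cdot y)=p(x)\cdot p(y)$ and $p(x)\cdot(y\cdot z)=(x\cdot y)\cdot p(z)$. A Nijenhuis family operator on $(L,\mu,p)$ is a collection of linear maps $\{N_\alpha:L\to L\}_{\alpha\in\Omega}$ with $p\circ N_\alpha=N_\alpha\circ p$ and $N_\alpha x\cdot N_\beta y=N_{\alpha\beta}\big(N_\alpha x\cdot y+x\cdot N_\beta y-N_{\alpha\beta}(x\cdot y)\big)$ for all $x,y\in L$, $\alpha,\beta\in\Omega$. A Hom-NS-family algebra $(G,\{\prec_\alpha,\succ_\alpha,\curlyvee_{\alpha,\beta}\}_{\alpha,\beta\in\Omega},p)$ is a vector space $G$ with bilinear operations $\prec_\alpha,\succ_\alpha,\curlyvee_{\alpha,\beta}:G\times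 G\to G$ and a linear map $p:G\to G$ preserving each operation such that for all $x,y,z\in G$, $\alpha,\beta,\gamma\in\Omega$: $p(x)\prec_{\alpha\beta}(y\prec_\beta z+y\succ_\alpha z+y\curlyvee_{\alpha,\beta}z)=(x\prec_\alpha y)\prec_\beta p(z)$; $(x\succ_\alpha y)\prec_\beta p(z)=p(x)\succ_\alpha(y\prec_\beta z)$; $(x\prec_\beta y+x\succ_\alpha y+x\curlyvee_{\alpha,\beta}y)\succ_{\alpha\beta}p(z)=p(x)\succ_\alpha(y\succ_\beta z)$; $p(x)\succ_\alpha(y\curlyvee_{\beta,\gamma}z)+p(x)\curlyvee_{\alpha,\beta\gamma}(y\prec_\gamma z+y\succ_\beta z+y\curlyvee_{\beta,\gamma}z)=(x\curlyvee_{\alpha,\beta}y)\prec_\gamma p(z)+(x\prec_\beta y+x\succ_\alpha y+x\curlyvee_{\alpha,\beta}y)\curlyvee_{\alpha\beta,\gamma}p(z)$. *)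

(* Defs.v *)
From HB Require Import structures.
From mathcomp Require Import all_boot all_order all_algebra.

Set Implicit Arguments.
Unset Strict Implicit.
Unset Printing Implicit Defensive.

Import GRing.Theory.
Local Open Scope ring_scope.

Record hom_associative_algebra (K : fieldType) (L : lmodType K)
    (mu : L -> L -> L) (p : L -> L) : Prop := HomAssociativeAlgebra {
  hom_assoc_bilinear : bilinear_for *:%R *:%R mu;
  hom_assoc_linear : linear p;
  hom_assoc_mult : forall x y, p (mu x y) = mu (p x) (p y);
  hom_assocA : forall x y z, mu (p x) (mu y z) = mu (mu x y) (p z)
}.

Record nijenhuis_family_operator (Omega : semigroupType) (K : fieldType)
    (L : lmodType K) (mu : L -> L -> L) (p : L -> L) (N : Omega -> L -> L) :
    Prop := NijenhuisFamilyOperator {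
  nijenhuis_linear : forall a, linear (N a);
  nijenhuis_comm : forall a x, p (N a x) = N a (p x);
  nijenhuis_eq : forall a b x y,
    mu (N a x) (N b y)
      = N (a * b)%g (mu (N a x) y + mu x (N b y) - N (a * b)%g (mu x y))
}.

(* The operations are curried with the semigroup indices first:
   x <_a y is [prec a x y], x >_a y is [succ a x y], and
   x Y_{a,b} y is [vee a b x y]. *)
Record hom_NS_family_algebra (Omega : semigroupType) (K : fieldType)
    (G : lmodType K) (prec succ : Omega -> G -> G -> G)
    (vee : Omega -> Omega -> G -> G -> G) (p : G -> G) :
    Prop := HomNSFamilyAlgebra {
  hom_NS_prec_bilinear : forall a, bilinear_for *:%R *:%R (prec a);
  hom_NS_succ_bilinear : forall a, bilinear_for *:%R *:%R (succ a);
  hom_NS_vee_bilinear : forall a b, bilinear_for *:%R *:%R (vee a b);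
  hom_NS_linear : linear p;
  hom_NS_prec_mult : forall a x y, p (prec a x y) = prec a (p x) (p y);
  hom_NS_succ_mult : forall a x y, p (succ a x y) = succ a (p x) (p y);
  hom_NS_vee_mult : forall a b x y, p (vee a b x y) = vee a b (p x) (p y);
  hom_NS_eq1 : forall a b x y z,
    prec (a * b)%g (p x) (prec b y z + succ a y z + vee a b y z)
      = prec b (prec a x y) (p z);
  hom_NS_eq2 : forall a b x y z,
    prec b (succ a x y) (p z) = succ a (p x) (prec b y z);
  hom_NS_eq3 : forall a b x y z,
    succ (a * b)%g (prec b x y + succ a x y + vee a b x y) (p z)
      = succ a (p x) (succ b y z);
  hom_NS_eq4 : forall a b c x y z,
    succ a (p x) (vee b c y z)
      + vee a (b * c)%g (p x) (prec c y z + succ b y z + vee b c y z)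
    = prec c (vee a b x y) (p z)
      + vee (a * b)%g c (prec b x y + succ a x y + vee a b x y) (p z)
}.

(* Main.v *)
Require Import Defs.
From HB Require Import structures.
From mathcomp Require Import all_boot all_order all_algebra.

Set Implicit Arguments.
Unset Strict Implicit.
Unset Printing Implicit Defensive.

Import GRing.Theory.
Local Open Scope ring_scope.

(** The Nijenhuis identity says that [N (a * b)] sends the total product
    [prec b x y + succ a x y + vee a b x y] to [mu (N a x) (N b y)]. With [p] commuting with [N],
    the first three axioms thus become Hom-associativity with [N] applied to two of the three
    factors. In the fourth, both sides collapse under one [N (a * b * c)]. *)

(** Packing a bare function as a linear map gives access to the generic additivity lemmas. *)
Lemma linear_morph (K : fieldType) (U V : lmodType K) (f : U -> V) :
  linear f -> {morph f : x y / x + y} * {morph f : x / - x}.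
Proof.
move=> fL.
pose F : {linear U -> V} := HB.pack f (GRing.isLinear.Build K U V _ f fL).
by split=> [x y|x]; [exact: (raddfD F) | exact: (raddfN F)].
Qed.

Theorem corollary3p14 (K : fieldType) (char0 : [pchar K] =i pred0)
    (Omega : semigroupType) (L : lmodType K) (mu : L -> L -> L) (p : L -> L)
    (N : Omega -> L -> L)
    (homL : hom_associative_algebra mu p)
    (nijN : nijenhuis_family_operator mu p N) :
  hom_NS_family_algebra
    (fun (a : Omega) (x y : L) => mu x (N a y))
    (fun (a : Omega) (x y : L) => mu (N a x) y)
    (fun (a b : Omega) (x y : L) => - N (a * b)%g (mu x y))
    p.
Proof.
case: homL => -[muDl muDr] pL pM muA; case: nijN => NL pN NE.
have ND a x y : N a (x + y) = N a x + N a y := (linear_morph (NL a)).1 x y.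
have muD x y z : mu (x + y) z = mu x z + mu y z := (linear_morph (muDl z)).1 x y.
have muN x y : mu (- x) y = - mu x y := (linear_morph (muDl y)).2 x.
have mulD x y z : mu x (y + z) = mu x y + mu x z := (linear_morph (muDr x)).1 y z.
have mulN x y : mu x (- y) = - mu x y := (linear_morph (muDr x)).2 y.
have pNN x : p (- x) = - p x := (linear_morph pL).2 x.
split=> //.
- move=> a; split=> [u k x y|u k x y] /=; first exact: muDl.
  by rewrite NL muDr.
- move=> a; split=> [u k x y|u k x y] /=; last exact: muDr.
  by rewrite NL muDl.
- move=> a b; split=> [u k x y|u k x y] /=.
    by rewrite muDl NL opprD scalerN.
  by rewrite muDr NL opprD scalerN.
- by move=> a x y; rewrite pM pN.
- by move=> a x y; rewrite pM pN.
- by move=> a b x y; rewrite pNN pN pM.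
(* The swap puts the argument of [N (a * b)] in the order of the Nijenhuis identity. *)
- by move=> a b x y z; rewrite [mu y _ + _]addrC -NE muA pN.
- by move=> a b x y z; rewrite -!pN muA.
- by move=> a b x y z; rewrite [mu x _ + _]addrC -NE -muA pN.
- move=> a b c x y z.
  (* Expanding N_a(p x) . N_(bc)(y z) and N_(ab)(x y) . N_c(p z) turns both
     sides into -N_(abc) of the same sum, up to one cancelling pair each. *)
  rewrite mulN muN !NE mulgA -!opprD -!ND; congr (- N _ _).
  (* The second [muA] pass is for [N c (p z)], which fits Hom-associativity only once [p] is
     outermost. *)
  rewrite !(mulD, muD, mulN, muN) -!muA -!pN -!muA.
  (* The isolated pairs are plus and minus [mu (p x) (N (b * c) (mu y z))] on the left,
     [mu (N (a * b) (mu x y)) (p z)] on the right. *)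
  by rewrite [LHS](AC (3*3) ((1*4*5*3)*(2*6)))
    [RHS](AC (3*3) ((5*2*4*3)*(1*6))) /= !subrr.
Qed.
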